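(* Let $(K,P)$ be an ordered field with valuation $v:K\to\Gamma\cup\{\infty\}$ determined by $P$. If $K$ is complete (with respect to the uniformity induced by $v$), then $K$ is continuous, i.e. every normal cut in $K$ is principal.
   Context: The valuation determined by the order $P$ of $K$ (with $P$ identified with its set of positive elements) is the one with valuation ring $A(P)=\{a\in K:\exists q\in\mathbb Q^+,\ q\pm a\in P\}$; $\Gamma$ is its value group. The uniformity on $K$ induced by $v$ has base $\{V_\gamma:\gamma\in\Gamma\}$ with $V_\gamma=\{(a,b)\in K\times K: v(a-b)>\gamma\}$. $K$ is complete if every centered family (i.e. family with the finite intersection property) $\mathcal F$ of closed subsets of $K$ which contains arbitrarily small sets has one-point intersection; $\mathcal F$ contains arbitrarily small sets if for every $\gamma\in\Gamma$ there is $F\in\mathcal F$ with $v(x-y)>\gamma$ for all $x,y\in F$. Equivalently, every Cauchy net in $K$ converges. A cut in $K$ is a pair $(A,B)$ with $A\cup B=K$ and $a<b$ for all $a\in A$, $b\in B$. It is normal if for every $c>0$ in $K$ there are $a\in A$, $b\in B$ with $b-a<c$. It is principal if $A$ has a maximal element or $B$ has a minimal element.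
   Formalization: The valuation v is additionally assumed nontrivial (K non-archimedean); for archimedean K the induced uniformity is discrete, so e.g. K = Q is complete although its normal cut at the square root of 2 is not principal. *)

(* Defs.v *)
From HB Require Import structures.
From mathcomp Require Import all_boot all_order all_algebra.
From mathcomp Require Import all_classical topology.

Set Implicit Arguments.
Unset Strict Implicit.
Unset Printing Implicit Defensive.

Import Order.TTheory GRing.Theory Num.Theory.
Local Open Scope classical_set_scope.
Local Open Scope ring_scope.

(* Totally ordered abelian groups, written additively. *)
HB.mixin Record isOrderedGroup G & Num.POrderedZmodule G := {
  ogroup_total : total (<=%R : rel G);
  ogroup_leD2l : forall z x y : G, x <= y -> z + x <= z + y
}.

#[short(type="ogroupType")]
HB.structure Definition OrderedGroup :=
  { G of isOrderedGroup G & Num.POrderedZmodule G }.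

(* [option G] stands for G extended by infinity, with [None] as infinity. *)
Section Extended.
Variable G : ogroupType.

Definition vadd (x y : option G) : option G :=
  if (x, y) is (Some a, Some b) then Some (a + b) else None.

Definition vle (x y : option G) : bool :=
  match x, y with
  | _, None => true
  | None, Some _ => false
  | Some a, Some b => a <= b
  end.

Definition vlt (x y : option G) : bool := ~~ vle y x.

Definition vmin (x y : option G) : option G := if vle x y then x else y.

End Extended.

Record valuation (K : fieldType) (G : ogroupType) := Valuation {
  val_fun :> K -> option G;
  valuation_infty : forall x, val_fun x = None <-> x = 0;
  valuationM : forall x y, val_fun (x * y) = vadd (val_fun x) (val_fun y);
  valuationD : forall x y, vle (vmin (val_fun x) (val_fun y)) (val_fun (x + y))
}.

Definition valuation_ring (K : fieldType) (G : ogroupType)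
    (v : valuation K G) : set K := [set a | vle (Some 0) (v a)].

(* The valuation determined by the order is trivial exactly when K is
   archimedean. It then induces the discrete uniformity, which is complete
   even for K = rat, although rat has normal cuts that are not principal. *)
Definition nontrivial_valuation (K : fieldType) (G : ogroupType)
    (v : valuation K G) : Prop := exists2 a : K, a != 0 & v a <> Some 0.

(* A(P), where P is the set of positive elements of K *)
Definition order_ring (K : realFieldType) : set K :=
  [set a | exists q : rat, [/\ 0 < q, 0 < ratr q + a & 0 < ratr q - a]].
Arguments order_ring : clear implicits.

(* The surjectivity clause makes G the value group of v; together the two
   clauses determine (G, v) up to a unique isomorphism. *)
Definition determined_by_order (K : realFieldType) (G : ogroupType)
    (v : valuation K G) : Prop :=
  (forall g : G, exists a : K, v a = Some g) /\
  valuation_ring v = order_ring K.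

Section ValuedUniform.
Variables (K : fieldType) (G : ogroupType) (v : valuation K G).

(* [valued v] is K carrying the uniformity induced by v. *)
Definition valued of valuation K G : Type := K.
HB.instance Definition _ := GRing.Field.copy (valued v) K.

Definition val_ball (g : G) : set (valued v * valued v) :=
  [set ab | vlt (Some g) (v ((ab.1 : K) - ab.2))].

Definition val_entourage : set_system (valued v * valued v) :=
  filter_from setT val_ball.

Lemma valuation0 : v 0 = None. Proof. exact/valuation_infty. Qed.

Lemma valuation1 : v 1 = Some 0.
Proof.
have := valuationM v 1 1; rewrite mulr1; case E : (v 1) => [a|] /=.
  by move=> [] /eqP; rewrite eq_sym -subr_eq0 addrK => /eqP ->.
by move/valuation_infty: E => /eqP; rewrite oner_eq0.
Qed.

Lemma valuationN1 : v (-1) = Some 0.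
Proof.
have := valuationM v (-1) (-1); rewrite mulrNN mulr1 valuation1.
case: (v (-1)) => [a|] //= [] h.
have h1 : a = - a by apply/eqP; rewrite -subr_eq0 opprK -h.
have /orP[h2|h2] := ogroup_total 0 a.
- have := ogroup_leD2l a _ _ h2; rewrite addr0 -h => h3.
  by congr Some; apply/eqP; rewrite eq_le h2 h3.
- have := ogroup_leD2l a _ _ h2; rewrite addr0 -h => h3.
  by congr Some; apply/eqP; rewrite eq_le h2 h3.
Qed.

Lemma valuationN x : v (- x) = v x.
Proof. by rewrite -mulN1r valuationM valuationN1; case: (v x) => [a|] //; rewrite /vadd add0r. Qed.

Lemma val_ball_split g a b c :
  val_ball g (a, b) -> val_ball g (b, c) -> val_ball g (a, c).
Proof.
rewrite /val_ball /vlt /= => h1 h2; have := valuationD v ((a : K) - b) ((b : K) - c).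
rewrite addrA subrK; move: h1 h2.
case: (v (a - c)) => [d|//]; rewrite /vmin; case: ifP => _.
  move=> h _; case: (v (a - b)) h => [d'|] //= /negP h le.
  by apply/negP => dg; apply: h; exact: le_trans dg.
move=> _; case: (v (b - c)) => [d'|] //= /negP h le.
by apply/negP => dg; apply: h; exact: le_trans dg.
Qed.

Lemma val_entourage_filter : Filter val_entourage.
Proof.
apply: filter_from_filter; first by exists 0.
move=> g h _ _; have /orP[gh|gh] := ogroup_total g h; [exists h|exists g] => //.
all: move=> [a b]; rewrite /val_ball /vlt /=.
all: case: (v _) => [d|] //= /negP dh; split=> //; apply/negP => // dg.
- by apply: dh; exact: le_trans gh.
- by apply: dh; exact: le_trans gh.
Qed.

Lemma val_entourage_diagonal A : val_entourage A -> diagonal `<=` A.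
Proof.
move=> [g _ gA] [x y] xy; have {xy}-> : x = y by [].
by apply: gA; rewrite /val_ball /vlt /= subrr valuation0.
Qed.

Lemma val_entourage_inv A : val_entourage A -> val_entourage (A^-1)%relation.
Proof.
move=> [g _ gA]; exists g => // -[a b] h; apply: gA.
by move: h; rewrite /val_ball /= -opprB valuationN.
Qed.

Lemma val_entourage_split A : val_entourage A ->
  exists2 B, val_entourage B & (B \; B)%relation `<=` A.
Proof.
move=> [g _ gA]; exists (val_ball g); first by exists g.
by move=> [a c] [b /= ab bc]; apply: gA; exact: val_ball_split ab bc.
Qed.

HB.instance Definition _ := isUniform.Build (valued v)
  val_entourage_filter val_entourage_diagonal val_entourage_inv
  val_entourage_split.

Definition arbitrarily_small_sets (F : set (set (valued v))) : Prop :=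
  forall g : G, exists2 S, F S &
    forall x y : K, S x -> S y -> vlt (Some g) (v (x - y)).

(* [finI F id] is the finite intersection property. *)
Definition complete_valued : Prop :=
  forall F : set (set (valued v)),
    finI F id -> (forall S, F S -> closed S) -> arbitrarily_small_sets F ->
    exists x, \bigcap_(S in F) S = [set x].

End ValuedUniform.

Section Cuts.
Variable K : realFieldType.

Definition cut (A B : set K) : Prop :=
  A `|` B = setT /\ forall a b, A a -> B b -> a < b.

Definition normal_cut (A B : set K) : Prop :=
  cut A B /\ forall c, 0 < c -> exists a b, [/\ A a, B b & b - a < c].

Definition principal_cut (A B : set K) : Prop :=
  (exists2 m, A m & forall a, A a -> a <= m) \/
  (exists2 m, B m & forall b, B b -> m <= b).

End Cuts.

Definition continuous_field (K : realFieldType) : Prop :=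
  forall A B : set K, normal_cut A B -> principal_cut A B.

(* Main.v *)
(* The valuation is monotone for absolute values, so order intervals are closed
   in the valuation topology; as the valuation is nontrivial, intervals of
   small length are also small in the valuation uniformity. For a normal cut
   (A, B), the intervals [a, b] with a in A and b in B therefore form a centered
   family of closed sets containing arbitrarily small sets, and a common point
   is the maximum of A or the minimum of B. *)
Require Import Defs.
From mathcomp Require Import all_boot all_order all_algebra.
From mathcomp Require Import all_classical topology.
From mathcomp Require Import finmap lra.

Set Implicit Arguments.
Unset Strict Implicit.
Unset Printing Implicit Defensive.

Import Order.TTheory GRing.Theory Num.Theory.
Local Open Scope classical_set_scope.
Local Open Scope ring_scope.

Section OrderValuation.
Variables (K : realFieldType) (G : ogroupType) (v : valuation K G).
Hypothesis v_order : determined_by_order v.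

(** For nonzero [s], the quotient [t / s] is bounded by 1 in absolute value, so it lies in
    [order_ring K], which is the valuation ring; multiplying back by [s] can only raise the
    value. *)
Lemma valuation_anti (s t : K) : `|t| <= `|s| -> vle (v s) (v t).
Proof.
have [->|s0] := eqVneq s 0.
  by rewrite normr0 normr_le0 => /eqP ->; case: (v 0) => /=.
move=> ts.
have : order_ring K (t / s).
  have : `|t / s| <= 1 by rewrite normf_div ler_pdivrMr ?normr_gt0 ?mul1r.
  rewrite ler_norml => /andP[? ?].
  (* The bound 2 makes the inequalities strict even when [t / s] is 1 or -1. *)
  by exists 2; rewrite rmorph_nat; split=> //; lra.
rewrite -v_order.2 /valuation_ring /= => vts.
have -> : v t = vadd (v (t / s)) (v s) by rewrite -valuationM divfK.
case: (v s) vts => [b|]; case: (v (t / s)) => [a|] //= a0.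
by have := ogroup_leD2l b _ _ a0; rewrite addr0 addrC.
Qed.

(** The ball of value radius [v d] around [x] lies within order distance [d] of [x], because
    [d <= |x - y|] would force [v (x - y) <= v d]. Hence a point outside the interval has a
    neighbourhood that misses it. *)
Lemma closed_interval (a b : K) :
  closed ([set y | a <= y <= b] : set (valued v)).
Proof.
have near_lt (x d : K) : 0 < d ->
    nbhs (x : valued v) [set y : valued v | `|(x : K) - y| < d].
  move=> d0; case vd : (v d) => [g|]; last first.
    by move/valuation_infty: vd d0 => ->; rewrite ltxx.
  rewrite -nbhs_entourageE; exists (val_ball g); first by exists g.
  move=> y /xsectionP; rewrite /val_ball /vlt /= -vd => /negP h.
  rewrite ltNge; apply/negP => dxy; apply: h; apply: valuation_anti.
  by rewrite (gtr0_norm d0).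
move=> x clx; rewrite /= !leNgt; apply/andP; split; apply/negP => hx.
- have [|y [/= /andP[ay _]]] := clx _ (near_lt x (a - x) _).
    by rewrite subr_gt0.
  by rewrite ltr_norml; lra.
- have [|y [/= /andP[_ yb]]] := clx _ (near_lt x (x - b) _).
    by rewrite subr_gt0.
  by rewrite ltr_norml; lra.
Qed.

Hypothesis v_nontrivial : nontrivial_valuation v.

(** A nonzero element of negative value has an inverse of positive value. *)
Lemma valuation_pos_exists : exists2 a : K, a != 0 & vlt (Some 0) (v a).
Proof.
have [a a0 va] := v_nontrivial.
have [a_pos|a_npos] := boolP (vlt (Some 0) (v a)); first by exists a.
exists a^-1; first by rewrite invr_eq0.
have := valuationM v a a^-1; rewrite divff // valuation1.
case: (v a) va a_npos => [g|] //= g0; rewrite /vlt negbK /= => g_le0.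
case: (v a^-1) => [h|] //= [gh]; apply/negP => h_le0.
apply: g0; congr Some; apply/eqP; rewrite eq_le g_le0 /=.
by have := ogroup_leD2l g _ _ h_le0; rewrite -gh addr0.
Qed.

Lemma small_norm_valuation (g : G) :
  exists2 c : K, 0 < c & forall x, `|x| <= c -> vlt (Some g) (v x).
Proof.
have [a a0 va] := valuation_pos_exists; have [e ve] := v_order.1 g.
have e0 : e != 0 by apply/eqP => /(valuation_infty v); rewrite ve.
(* The factor [e] has value [g], and [a] pushes the value of the product strictly above [g]. *)
exists `|a * e|; first by rewrite normr_gt0 mulf_neq0.
move=> x /valuation_anti; rewrite valuationM ve.
case: (v x) => [h|//]; case: (v a) va => [k|//]; rewrite /vlt /= => k_pos le_h.
apply: contra k_pos => hg; have := ogroup_leD2l (- g) _ _ (le_trans le_h hg).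
by rewrite addNr addrCA addNr addr0.
Qed.

End OrderValuation.

(** By induction, finitely many such intervals all contain one of the same kind, from the largest
    left endpoint to the smallest right one; it contains its own left endpoint. Nonemptiness of [A]
    and [B] covers the empty subfamily. *)
Lemma cut_intervals_finI (K : realFieldType) (A B : set K) :
  cut A B -> A !=set0 -> B !=set0 ->
  finI [set S | exists a b, [/\ A a, B b & S = [set y | a <= y <= b]]] id.
Proof.
move=> [_ ltAB] [a0 Aa0] [b0 Bb0] D DF.
have [a [b [Aa Bb ab]]] : exists a b, [/\ A a, B b &
    forall S, S \in (enum_fset D) -> [set y | a <= y <= b] `<=` S].
  have : forall S, S \in (enum_fset D) ->
      exists a b, [/\ A a, B b & S = [set y | a <= y <= b]].
    by move=> S /DF /set_mem.
  elim: (enum_fset D) => [|S s IH] sF; first by exists a0, b0.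
  have [|a [b [Aa Bb ab]]] := IH.
    by move=> T Ts; apply: sF; rewrite inE Ts orbT.
  have [|a' [b' [Aa' Bb' Sab']]] := sF S; first by rewrite inE eqxx.
  exists (Num.max a a'), (Num.min b b'); split.
  - by case: leP.
  - by case: leP.
  move=> T; rewrite inE => /orP[/eqP ->|/ab abT] y /=;
    rewrite ge_max le_min => /andP[/andP[ay a'y] /andP[yb yb']].
  + by rewrite Sab' /= a'y.
  + by apply: abT; rewrite /= ay.
by exists a => S /= SD; apply: (ab S SD); rewrite /= lexx ltW // ltAB.
Qed.

Theorem theorem3p7 (K : realFieldType) (G : ogroupType) (v : valuation K G)
    (v_order : determined_by_order v)
    (v_nontrivial : nontrivial_valuation v)
    (K_complete : complete_valued v) :
  continuous_field K.
Proof.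
move=> A B [cutAB normalAB].
(* Normality at an arbitrary positive bound shows that both sides of the cut are inhabited. *)
have [a0 [b0 [Aa0 Bb0 _]]] := normalAB 1 ltr01.
pose F : set (set (valued v)) :=
  [set S | exists a b, [/\ A a, B b & S = [set y : K | a <= y <= b]]].
have [||g|x Fx] := K_complete F.
- by apply: cut_intervals_finI => //; [exists a0|exists b0].
- by move=> S [a [b [_ _ ->]]]; exact: closed_interval.
- have [c c0 small_c] := small_norm_valuation v_order v_nontrivial g.
  have [a [b [Aa Bb ab]]] := normalAB _ c0.
  exists [set y : K | a <= y <= b]; first by exists a, b.
  move=> x y /= /andP[ax xb] /andP[ay yb]; apply: small_c.
  by rewrite ler_norml; lra.
have xAB a b : A a -> B b -> a <= x <= b.
  have : (\bigcap_(S in F) S) x by rewrite Fx.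
  by move=> xF Aa Bb; apply: (xF [set y : K | a <= y <= b]); exists a, b.
have : (A `|` B) x by rewrite cutAB.1.
case=> [Ax|Bx]; [left|right]; exists x => // y.
- by move=> Ay; have /andP[] := xAB _ _ Ay Bb0.
- by move=> By; have /andP[] := xAB _ _ Aa0 By.
Qed.
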